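(* Let $C$ be a binary quasi-cyclic code whose parity-check matrix, after permuting rows and columns, is an $s\lambda\times s\rho$ array of $L\times L$ circulant matrices over $\mathrm{GF}(2)$, with $s\lambda\times s\rho$ weight matrix $A=(a_{x,y})$. For $S\subseteq\{1,\dots,s\rho\}$ with $|S|=s\lambda+1$, define $$\psi(S)=\sum_{\substack{S'\subset S\\ S'=\{i_1,\dots,i_{s\lambda}\}}}\ \sum_{\sigma\in\Pi} a_{\sigma(1),i_1}a_{\sigma(2),i_2}\cdots a_{\sigma(s\lambda),i_{s\lambda}},$$ where $\Pi$ is the set of all permutations of $\{1,\dots,s\lambda\}$. In other words, $\psi(S)$ is the sum, over all $s\lambda$-element subsets $S'$ of $S$, of the permanent of the submatrix of $A$ formed by the columns in $S'$. Then $$d_{\min}(C)\le \min\{\psi(S): S\subseteq\{1,\dots,s\rho\},\ |S|=s\lambda+1,\ \psi(S)\ne 0\}.$$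
   Context: $s,\lambda,\rho,L$ are positive integers. The weight matrix $A$ of such a parity-check matrix has entry $a_{x,y}$ equal to the number of ones in any row of the circulant block in block-row $x$ and block-column $y$. $d_{\min}(C)$ denotes the minimum Hamming weight of a nonzero codeword of $C$. *)

(* Defs.v *)
From mathcomp Require Import all_boot all_order all_algebra all_fingroup.
Set Implicit Arguments. Unset Strict Implicit. Unset Printing Implicit Defensive.
Import GRing.Theory.
Local Open Scope ring_scope.

(* The (x,y) block (of size L x L) of an (m*L) x (n*L) matrix:
   rows x*L + i, columns y*L + j. *)
Definition block (R : Type) (m n L : nat) (M : 'M[R]_(m * L, n * L))
  (x : 'I_m) (y : 'I_n) : 'M[R]_L :=
  \matrix_(i, j) M (mxvec_index x i) (mxvec_index y j).

Definition circulant (R : Type) (L : nat) (B : 'M[R]_L) : Prop :=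
  forall i j i' j' : 'I_L,
    ((j + L - i) %% L = (j' + L - i') %% L)%N -> B i j = B i' j'.

Definition permanent (m : nat) (B : 'M[nat]_m) : nat :=
  (\sum_(sigma : 'S_m) \prod_(k : 'I_m) B (sigma k) k)%N.

(* Permanent of the submatrix of A formed by the columns in S'
   (listed increasingly); 0 if #|S'| <> m. *)
Definition perm_cols (m n : nat) (A : 'M[nat]_(m, n)) (S' : {set 'I_n}) : nat :=
  match (#|S'| =P m) with
  | ReflectT e => permanent (colsub (fun k : 'I_m => enum_val (cast_ord (esym e) k)) A)
  | ReflectF _ => 0%N
  end.

Definition psi (m n : nat) (A : 'M[nat]_(m, n)) (S : {set 'I_n}) : nat :=
  (\sum_(S' : {set 'I_n} | (S' \subset S) && (#|S'| == m)) perm_cols A S')%N.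

Definition is_codeword (r N : nat) (H : 'M['F_2]_(r, N)) (c : 'rV['F_2]_N) : Prop :=
  H *m c^T = 0.

Definition wt (N : nat) (c : 'rV['F_2]_N) : nat := #|[set j : 'I_N | c 0 j != 0]|.

(* Main.v *)
Require Import Defs.
From mathcomp Require Import all_boot all_order all_algebra all_fingroup.
Set Implicit Arguments. Unset Strict Implicit. Unset Printing Implicit Defensive.
Import GRing.Theory.
Local Open Scope ring_scope.

(** Circulant blocks are polynomials in the cyclic shift, so the columns in S
    give an m x (m+1) matrix h over a commutative ring, and the usual candidate
    codeword is the vector of its maximal minors, whose j-th entry has weight at
    most the permanent of A without column j.

    These minors may all vanish in F_2[x]/(x^L - 1) although psi(S) <> 0.
    Nonvanishing of psi(S) gives an injection f of the rows into S with
    a_{i,f(i)} > 0. For a set I of rows, replace each row i outside I by the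
    unit vector e_{f(i)}, and let c^I be the vector of maximal minors of the
    result. As e_{f(i)} <= a_i entrywise, the weight bound psi(S) persists.
    For I empty, c^I has an entry +-1. For I maximal with c^I <> 0, the vector
    c^I is a codeword: h_i . c^I vanishes for i in I by a repeated row, and for
    i outside I it is, up to sign, an entry of c^(I + i), zero by maximality. *)

(** * Maximal minors of padded matrices *)

Section PaddedMatrix.
Variables (R : comNzRingType) (m : nat) (h : 'M[R]_(m, m.+1)).
Variable f : 'I_m -> 'I_m.+1.

(* Row 0 is the free row [u]; row [lift ord0 k] stands for row [k] of [h]. *)
Definition padded_mx (I : {set 'I_m}) (u : 'I_m.+1 -> R) : 'M[R]_m.+1 :=
  \matrix_(i, j) if unlift ord0 i is Some k
                 then (if k \in I then h k j else (j == f k)%:R) else u j.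

(** The entry [j] of [c^I]: a unit vector in the free row cuts the determinant down to the signed
    minor without column [j]. *)
Definition padded_det I j := \det (padded_mx I (fun k => (k == j)%:R)).

(** Laplace expansion along the free row, whose cofactors do not depend on [u]. *)
Lemma det_padded_mx I u :
  \det (padded_mx I u) = \sum_j u j * padded_det I j.
Proof.
rewrite (expand_det_row _ ord0); apply: eq_bigr => j _.
rewrite mxE unlift_none; congr (_ * _).
rewrite /padded_det (expand_det_row _ ord0) (bigD1 j) //= big1.
  rewrite mxE unlift_none eqxx mul1r addr0 /cofactor; congr (_ * \det _).
  by apply/matrixP=> a b; rewrite !mxE liftK.
by move=> k /negPf kj; rewrite mxE unlift_none kj mul0r.
Qed.

Lemma padded_det_in (I : {set 'I_m}) i : i \in I -> \sum_j h i j * padded_det I j = 0.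
Proof.
move=> iI; rewrite -det_padded_mx.
apply: (determinant_alternate (neq_lift ord0 i)) => j.
by rewrite !mxE unlift_none liftK iI.
Qed.

Lemma padded_det_notin (I : {set 'I_m}) i : i \notin I ->
  \sum_j h i j * padded_det I j = - padded_det (i |: I) (f i).
Proof.
move=> iI; rewrite -det_padded_mx /padded_det.
set M := padded_mx _ _; set N := padded_mx _ _.
(* [M] has [h i] in the free row and the unit vector at [f i] in the row of [i]; [N] has them
   exchanged, which costs one sign. *)
have -> : M = xrow ord0 (lift ord0 i) N.
  apply/matrixP=> a j; rewrite !mxE.
  case: tpermP => [->|->|].
  - by rewrite unlift_none liftK setU11.
  - by rewrite unlift_none liftK (negPf iI).
  case: unliftP => [k ->|-> //] _ kNi.
  by rewrite !inE; case: (eqVneq k i) => [ki|//]; rewrite ki in kNi.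
by rewrite /xrow row_permE det_mulmx det_perm odd_tperm neq_lift expr1 mulN1r.
Qed.

(** With no row of [h] kept, the padded matrix is the permutation matrix of [s]. *)
Lemma padded_det_set0 (s : 'S_m.+1) : (forall i, f i = s (lift ord0 i)) ->
  padded_det set0 (s ord0) = (-1) ^+ s.
Proof.
move=> fs; rewrite /padded_det -(det_perm R s); congr (\det _).
apply/matrixP=> i j; rewrite !mxE eq_sym.
by case: unliftP => [k ->|->]; rewrite ?inE 1?eq_sym ?fs // eq_sym.
Qed.

End PaddedMatrix.

(** * Weights of determinants and the choice of [c] *)

Section WeightedCramer.
Variables (R : comNzRingType) (T : nzRingType) (phi : {rmorphism R -> T}).
Variable w : R -> nat.
Hypothesis w0 : w 0 = 0%N.
Hypothesis w1 : (w 1 <= 1)%N.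
Hypothesis wN : forall a, w (- a) = w a.
Hypothesis wD : forall a b, (w (a + b) <= w a + w b)%N.
Hypothesis wM : forall a b, (w (a * b) <= w a * w b)%N.

Lemma weight_sum (I : finType) (P : pred I) (F : I -> R) :
  (w (\sum_(i | P i) F i) <= \sum_(i | P i) w (F i))%N.
Proof.
apply: (big_ind2 (fun a b => w a <= b)%N) => [|a b c d ab cd|//].
  by rewrite w0.
exact: leq_trans (wD _ _) (leq_add ab cd).
Qed.

Lemma weight_det n (M : 'M[R]_n) (B : 'M[nat]_n) :
  (forall i j, w (M i j) <= B i j)%N ->
  (w (\det M) <= \sum_(s : 'S_n) \prod_i B i (s i))%N.
Proof.
move=> MB; apply: leq_trans (weight_sum _ _) _; apply: leq_sum => s _.
have -> a : w ((-1) ^+ s * a) = w a.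
  by case: (odd_perm s); rewrite ?mulN1r ?mul1r ?wN.
apply: (big_ind2 (fun a b => w a <= b)%N) => [|a b c d ab cd|i _] //.
exact: leq_trans (wM _ _) (leq_mul ab cd).
Qed.

(** Minors are formed in the commutative ring [R], but vanishing is tested in [T]: the maximal [I]
    is taken among those whose minors do not all die under [phi]. The values of [s0] off [ord0]
    serve as [f]. *)
Lemma weighted_cramer m (h : 'M[R]_(m, m.+1)) (B : 'M[nat]_(m, m.+1))
    (s0 : 'S_m.+1) :
  (forall i j, w (h i j) <= B i j)%N ->
  (forall i, 0 < B i (s0 (lift ord0 i)))%N ->
  exists c : 'I_m.+1 -> R,
    [/\ exists j, phi (c j) != 0,
        forall i, phi (\sum_j h i j * c j) = 0
      & (\sum_j w (c j) <=
          \sum_(s : 'S_m.+1) \prod_i B i (s (lift ord0 i)))%N].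
Proof.
move=> hB B0; pose f i := s0 (lift ord0 i).
pose P I := [exists j, phi (padded_det h f I j) != 0].
have P0 : P set0.
  apply/existsP; exists (s0 ord0); rewrite padded_det_set0 //.
  by rewrite rmorph_sign signr_eq0.
case: (arg_maxnP (fun I : {set 'I_m} => #|I|) P0) => I /existsP[j PI] maxI.
exists (padded_det h f I); split; first by exists j.
  move=> i; have [iI|iI] := boolP (i \in I).
    by rewrite padded_det_in // rmorph0.
  rewrite padded_det_notin // rmorphN; apply/eqP; rewrite oppr_eq0.
  apply: contraT => nz.
  have /maxI : P (i |: I) by apply/existsP; exists (f i).
  by rewrite /= cardsU1 iI add1n ltnn.
(* Grouping the permutations by the column [k] chosen in row [ord0] leaves one bound per entry
   [c k]. *)
rewrite (partition_big (fun s : 'S_m.+1 => s ord0) predT) //=.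
apply: leq_sum => k _.
(* [C] dominates the weights of the padded matrix: [B0] covers the replaced rows, and the unit row
   kills every permutation with [s ord0 != k]. *)
pose C : 'M[nat]_m.+1 := \matrix_(i, l)
  if unlift ord0 i is Some i' then B i' l else nat_of_bool (l == k).
apply: leq_trans (weight_det (B := C) _) _ => [i l|].
  have wb (b : bool) : (w b%:R <= b)%N by case: b; rewrite ?w0.
  rewrite !mxE; case: unliftP => [i' _|_] //.
  case: ifP => // _; apply: leq_trans (wb _) _.
  by case: eqP => // ->; apply: B0.
rewrite (bigID (fun s : 'S_m.+1 => s ord0 == k)) /= [X in (_ + X)%N]big1 ?addn0.
  apply: leq_sum => s /eqP sk; rewrite big_ord_recl mxE unlift_none sk eqxx mul1n.
  by apply: leq_prod => i _; rewrite mxE liftK.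
by move=> s /negPf sk; rewrite big_ord_recl mxE unlift_none sk mul0n.
Qed.

End WeightedCramer.

(** * [psi] as a sum over injections of the rows into [S] *)

Lemma perm_colsE m n (A : 'M[nat]_(m, n)) (S : {set 'I_n}) :
  perm_cols A S = (\sum_(t : {ffun 'I_m -> 'I_n} | injectiveb t && (t @: setT == S))
    \prod_k A k (t k))%N.
Proof.
(* An injection of ['I_m] has an image of size [m], so the sum is empty and agrees with the default
   value 0. *)
rewrite /perm_cols; case: eqP => [e|ne]; last first.
  rewrite big_pred0 // => t; apply/negP => /andP[/injectiveP ti /eqP tS].
  by case: ne; rewrite -tS card_imset // cardsT card_ord.
pose ev (k : 'I_m) : 'I_n := enum_val (cast_ord (esym e) k).
have evI : injective ev by move=> a b /enum_val_inj /cast_ord_inj.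
have evS k : ev k \in S by apply: enum_valP.
(* The inverse appears because [permanent] assigns a row to each column, while injections assign a
   column to each row. *)
pose F (s : 'S_m) := [ffun k => ev (s^-1%g k)].
have FI : injective F.
  move=> s t /ffunP st; apply: invg_inj; apply/permP => k.
  by move: (st k); rewrite !ffunE => /evI.
have FE : F @: setT = [set t : {ffun 'I_m -> 'I_n} | injectiveb t && (t @: setT == S)].
  apply/setP=> t; rewrite inE; apply/imsetP/andP => [[s _ ->]|[/injectiveP ti /eqP tS]].
    have Fi : injective (F s) by move=> a b; rewrite !ffunE => /evI /perm_inj.
    split; first by apply/injectiveP.
    rewrite eqEcard card_imset // cardsT card_ord e leqnn andbT.
    by apply/subsetP => _ /imsetP[k _ ->]; rewrite ffunE.
  have tin k : t k \in S by rewrite -tS imset_f.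
  pose g k := cast_ord e (enum_rank_in (tin k) (t k)).
  have gK k : ev (g k) = t k by rewrite /ev /g cast_ordK enum_rankK_in.
  have gI : injective g by move=> a b ab; apply: ti; rewrite -!gK ab.
  by exists (perm gI)^-1%g => //; apply/ffunP => k; rewrite ffunE invgK permE gK.
rewrite [RHS](eq_bigl (fun t => t \in F @: setT)); last by move=> t; rewrite FE inE.
rewrite big_imset /=; last by move=> ? ? _ _; apply: FI.
rewrite /permanent; apply: eq_big => [s|s _]; first by rewrite inE.
rewrite [RHS](reindex_inj (@perm_inj _ s)); apply: eq_bigr => k _.
by rewrite mxE ffunE permK.
Qed.

Lemma psiE m n (A : 'M[nat]_(m, n)) (S : {set 'I_n}) :
  psi A S = (\sum_(t : {ffun 'I_m -> 'I_n} | injectiveb t && (t @: setT \subset S))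
    \prod_k A k (t k))%N.
Proof.
rewrite /psi (partition_big (fun t : {ffun 'I_m -> 'I_n} => t @: setT)
  (fun S' : {set 'I_n} => (S' \subset S) && (#|S'| == m))) /=; last first.
  by move=> t /andP[/injectiveP ti ->]; rewrite card_imset // cardsT card_ord /=.
apply: eq_bigr => S' /andP[sS _]; rewrite perm_colsE; apply: eq_bigl => t.
by case: eqP => [->|]; rewrite ?sS ?andbT ?andbF.
Qed.

(** A permutation is determined by its values off [ord0], so distinct permutations give distinct
    injections into [S], all counted in [psiE]. *)
Lemma leq_sum_psi m n (A : 'M[nat]_(m, n)) (S : {set 'I_n}) (e : 'I_m.+1 -> 'I_n) :
  injective e -> (forall j, e j \in S) ->
  (\sum_(s : 'S_m.+1) \prod_i A i (e (s (lift ord0 i))) <= psi A S)%N.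
Proof.
move=> eI eS; pose F (s : 'S_m.+1) := [ffun k => e (s (lift ord0 k))].
have FI : injective F.
  move=> s t /ffunP st; have {}st k : s (lift ord0 k) = t (lift ord0 k).
    by apply: eI; move: (st k); rewrite !ffunE.
  apply/permP => i; case: (unliftP ord0 i) => [k ->|->]; first exact: st.
  case: (unliftP ord0 (t^-1%g (s ord0))) => [k tk|tk]; last by rewrite -[in RHS]tk permKV.
  have /perm_inj : s ord0 = s (lift ord0 k) by rewrite st -tk permKV.
  by move/eqP; rewrite (negPf (neq_lift _ _)).
rewrite psiE.
rewrite (eq_bigr (fun s => (\prod_k A k (F s k))%N)); last first.
  by move=> s _; apply: eq_bigr => k _; rewrite ffunE.
rewrite (eq_bigl (fun s => s \in setT)); last by move=> s; rewrite inE.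
rewrite -(big_imset (fun t : {ffun 'I_m -> 'I_n} => (\prod_k A k (t k))%N)) /=; last first.
  by move=> ? ? _ _; apply: FI.
rewrite [leqRHS](bigID (mem (F @: setT))) /= (leq_trans _ (leq_addr _ _)) //.
apply/eq_leq/eq_bigl => t; apply/idP/andP => [tF|[]//]; split=> //.
case/imsetP: tF => s _ ->; apply/andP; split.
  by apply/injectiveP => a b; rewrite !ffunE => /eI/perm_inj/lift_inj.
by apply/subsetP => _ /imsetP[k _ ->]; rewrite ffunE.
Qed.

Lemma injection_extends_to_perm m (f : 'I_m -> 'I_m.+1) : injective f ->
  exists s : 'S_m.+1, forall i, s (lift ord0 i) = f i.
Proof.
(* Counting gives a value [j0] that [f] misses; it becomes the image of [ord0]. *)
move=> fI; have /subsetPn[j0 _ j0f] : ~~ (setT \subset f @: setT).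
  apply/negP => /subset_leq_card.
  by rewrite card_imset // !cardsT !card_ord ltnn.
pose g i := if unlift ord0 i is Some k then f k else j0.
have j0F k : f k = j0 -> False by move=> fk; rewrite -fk imset_f in j0f.
have gI : injective g.
  move=> a b; rewrite /g.
  case: unliftP => [k ->|->]; case: unliftP => [l ->|->] //.
  - by move/fI ->.
  - by move/j0F.
  - by move/esym/j0F.
by exists (perm gI) => i; rewrite permE /g liftK.
Qed.

(** Some injection has a nonzero product, hence only nonzero factors; pulled back along [e], it
    extends to a permutation. *)
Lemma psi_neq0_matching m n (A : 'M[nat]_(m, n)) (S : {set 'I_n})
    (e : 'I_m.+1 -> 'I_n) :
  (forall y, y \in S -> exists j, e j = y) -> psi A S <> 0%N ->
  exists s : 'S_m.+1, forall i, (0 < A i (e (s (lift ord0 i))))%N.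
Proof.
move=> eS /eqP; rewrite psiE sum_nat_eq0 negb_forall => /existsP[t].
rewrite negb_imply => /andP[/andP[/injectiveP tI /subsetP tS] At].
have /fin_all_exists[f fE] k : exists j, e j = t k by apply/eS/tS/imset_f.
have fI : injective f by move=> a b ab; apply: tI; rewrite -!fE ab.
have [s sE] := injection_extends_to_perm fI.
exists s => i; rewrite sE fE lt0n; apply: contra At => /eqP Ai.
by rewrite (bigD1 i) //= Ai.
Qed.

(** * Hamming weight of polynomials *)

Section PolyWeight.
Variable F : fieldType.
Implicit Types p q : {poly F}.

Definition poly_weight p : nat := count (fun a => a != 0) p.

Lemma poly_weight_sum n p : (size p <= n)%N ->
  poly_weight p = (\sum_(i < n) (p`_i != 0)%R)%N.
Proof.
move=> pn; rewrite /poly_weight -sumn_count -(big_mkord xpredT (fun i => nat_of_bool (p`_i != 0))).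
rewrite (big_cat_nat (leq0n (size p)) pn) /= [X in (_ + X)%N]big_nat_cond [X in (_ + X)%N]big1 ?addn0.
  by rewrite sumnE big_map (big_nth 0).
by move=> i /andP[/andP[pi _] _]; rewrite nth_default // eqxx.
Qed.

Lemma poly_weight0 : poly_weight 0 = 0%N.
Proof. by rewrite /poly_weight polyseq0. Qed.

Lemma poly_weight1 : (poly_weight 1 <= 1)%N.
Proof. by rewrite /poly_weight polyseq1 /= addn0 leq_b1. Qed.

Lemma poly_weightN p : poly_weight (- p) = poly_weight p.
Proof.
rewrite !(@poly_weight_sum (size p)) ?size_polyN //.
by apply: eq_bigr => i _; rewrite coefN oppr_eq0.
Qed.

Lemma poly_weightD p q : (poly_weight (p + q)%R <= poly_weight p + poly_weight q)%N.
Proof.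
have [lp lq] := (leq_maxl (size p) (size q), leq_maxr (size p) (size q)).
rewrite (poly_weight_sum (size_polyD p q)) (poly_weight_sum lp) (poly_weight_sum lq).
rewrite -big_split /=; apply: leq_sum => i _; rewrite coefD.
have [->|_] := eqVneq p`_i 0; first by rewrite add0r.
exact: leq_trans (leq_b1 _) (leq_addr _ _).
Qed.

Lemma poly_weightZXn a n p :
  (poly_weight (a *: ('X^n * p))%R <= (a != 0)%R * poly_weight p)%N.
Proof.
have [->|a0] := eqVneq a 0; first by rewrite scale0r poly_weight0.
have [->|p0] := eqVneq p 0; first by rewrite mulr0 scaler0 poly_weight0.
rewrite mul1n (@poly_weight_sum (size ('X^n * p))) ?size_scale //.
rewrite [leqRHS](_ : _ = poly_weight ('X^n * p)); last first.
  by rewrite /poly_weight mulrC polyseqMXn // -cat_nseq count_cat count_nseq eqxx.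
rewrite (@poly_weight_sum (size ('X^n * p))) //.
by apply: leq_sum => i _; rewrite coefZ mulf_eq0 (negPf a0).
Qed.

(** Expanding [p] into monomials reduces the bound to subadditivity and to multiples by one
    monomial. *)
Lemma poly_weightM p q : (poly_weight (p * q)%R <= poly_weight p * poly_weight q)%N.
Proof.
rewrite -[p in (p * q)]coefK poly_def mulr_suml.
apply: leq_trans (weight_sum poly_weight0 poly_weightD _ _) _.
rewrite (poly_weight_sum (leqnn (size p))) big_distrl /=.
by apply: leq_sum => i _; rewrite -scalerAl poly_weightZXn.
Qed.

End PolyWeight.

(** * Circulants as polynomials in the cyclic shift *)

Section CyclicShift.
Variables (F : fieldType) (L : nat).

Definition shift_mx : 'M[F]_L.+1 := \matrix_(i, j) (j == i + inZp 1)%:R.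

Lemma shift_mxX k : shift_mx ^+ k = \matrix_(i, j) (j == i + inZp k)%:R.
Proof.
elim: k => [|k IH]; apply/matrixP=> i j.
  by rewrite expr0 !mxE (_ : inZp 0 = 0) ?addr0 1?eq_sym //; apply: val_inj; rewrite /= mod0n.
rewrite exprSr IH !mxE (bigD1 (i + inZp k)) //= !mxE eqxx mul1r big1 ?addr0.
  congr (_ == _)%:R; rewrite -addrA; congr (_ + _).
  by apply: val_inj; rewrite /= modnDm addn1.
by move=> l /negPf lk; rewrite mxE lk mul0r.
Qed.

Lemma horner_shiftE (p : {poly F}) i j :
  horner_mx shift_mx p i j = \sum_(k < size p) p`_k * (j == i + inZp k)%:R.
Proof.
rewrite -[p in LHS]coefK poly_def rmorph_sum summxE; apply: eq_bigr => k _.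
by rewrite /= horner_mxZ rmorphXn /= horner_mx_X shift_mxX !mxE.
Qed.

(** The entry at [(i, j)] depends only on [j - i], so column 0 determines the matrix. *)
Lemma horner_shift_col0 (p : {poly F}) : (forall i, horner_mx shift_mx p i 0 = 0) ->
  horner_mx shift_mx p = 0.
Proof.
move=> p0; apply/matrixP => i j; rewrite mxE -(p0 (i - j)) !horner_shiftE.
apply: eq_bigr => k _; congr (_ * (_)%:R).
by rewrite [0 == _]eq_sym addrAC subr_eq0 eq_sym.
Qed.

(** The term of degree [k] meets column 0 only in row [-k]; collisions can only lower the count. *)
Lemma horner_shift_weight (p : {poly F}) :
  (#|[set i | (horner_mx shift_mx p i 0 != 0)%R]| <= poly_weight p)%N.
Proof.
rewrite (poly_weight_sum (leqnn _)) -sum1_card.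
apply: (@leq_trans (\sum_(i : 'I_L.+1) \sum_(k < size p) (p`_k != 0)%R * (0 == i + inZp k)%R)%N).
  rewrite big_mkcond /=; apply: leq_sum => i _; rewrite inE horner_shiftE.
  case: ifP => // nz; rewrite lt0n; apply: contraTneq nz => /eqP.
  rewrite sum_nat_eq0 => /forallP z; rewrite negbK big1 // => k _.
  move: (z k); rewrite muln_eq0 !eqb0 negbK => /orP[/eqP ->|/negPf ->].
    by rewrite mul0r.
  by rewrite mulr0.
rewrite exchange_big /=; apply: leq_sum => k _.
rewrite -big_distrr /= -[leqRHS]muln1 leq_mul2l; apply/orP; right.
rewrite (bigD1 (- inZp (val k))) //= big1 ?addn0 ?leq_b1 // => i ik.
by rewrite eq_sym addr_eq0 (negPf ik).
Qed.

(** The [k]-th power of the shift has its single one of row 0 in column [k], so row 0 supplies the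
    coefficients. *)
Lemma horner_shift_circulant (B : 'M[F]_L.+1) : circulant B ->
  horner_mx shift_mx (\poly_(k < L.+1) B 0 (inord k)) = B.
Proof.
move=> cB; apply/matrixP=> i j.
rewrite poly_def rmorph_sum summxE.
rewrite (eq_bigr (fun k : 'I_L.+1 => B 0 k * (k == j - i)%:R)); last first.
  move=> k _; rewrite /= horner_mxZ rmorphXn /= horner_mx_X shift_mxX !mxE inord_val.
  rewrite (_ : inZp k = k); last by apply: val_inj; rewrite /= modn_small.
  by rewrite addrC -subr_eq eq_sym.
rewrite (bigD1 (j - i)) //= big1 ?addr0 => [|k /negPf ->]; last by rewrite mulr0.
rewrite eqxx mulr1; apply: cB.
by rewrite subn0 modnDr /= modn_mod modnDmr addnBA // ltnW.
Qed.

Lemma poly_weight_row (B : 'M[F]_L.+1) :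
  (poly_weight (\poly_(k < L.+1) B 0 (inord k))%R <= #|[set j | (B 0 j != 0)%R]|)%N.
Proof.
rewrite (poly_weight_sum (size_poly _ _)) -sum1_card [leqRHS]big_mkcond /=.
by apply: leq_sum => k _; rewrite coef_poly ltn_ord inord_val inE; case: (_ == 0).
Qed.

End CyclicShift.

(** * Assembly of the codeword *)

Lemma reindex_mxvec (T : Type) (idx : T) (op : Monoid.com_law idx) m n
    (G : 'I_(m * n) -> T) :
  \big[op/idx]_j G j = \big[op/idx]_i \big[op/idx]_k G (mxvec_index i k).
Proof.
rewrite pair_bigA (reindex _ (curry_mxvec_bij m n)) /=.
by apply: eq_bigr => -[i k].
Qed.

Lemma block_circulant_codeword m n L (M : 'M['F_2]_(m * L.+1, n * L.+1))
    (A : 'M[nat]_(m, n)) (S : {set 'I_n}) :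
  (forall x y, circulant (block M x y)) ->
  (forall x y (i : 'I_L.+1), #|[set j | block M x y i j != 0]| = A x y) ->
  #|S| = m.+1 -> psi A S <> 0%N ->
  exists c : 'rV['F_2]_(n * L.+1),
    [/\ c != 0, is_codeword M c & (wt c <= psi A S)%N].
Proof.
move=> circM wtM cS psi0.
pose phi : {rmorphism {poly 'F_2} -> 'M['F_2]_L.+1} := horner_mx (shift_mx 'F_2 L).
pose hp x y : {poly 'F_2} := \poly_(k < L.+1) block M x y 0 (inord k).
have phi_hp x y : phi (hp x y) = block M x y by apply: horner_shift_circulant.
pose e (j : 'I_m.+1) : 'I_n := enum_val (cast_ord (esym cS) j).
have eI : injective e by move=> a b /enum_val_inj /cast_ord_inj.
have eS j : e j \in S by apply: enum_valP.
have e_onto y : y \in S -> exists j, e j = y.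
  move=> yS; exists (cast_ord cS (enum_rank_in yS y)).
  by rewrite /e cast_ordK enum_rankK_in.
have [s0 s0P] := psi_neq0_matching e_onto psi0.
have hB i j : (poly_weight ((\matrix_(i, j) hp i (e j)) i j) <=
               (\matrix_(i, j) A i (e j)) i j)%N.
  by rewrite !mxE -(wtM i (e j) 0) poly_weight_row.
have [|q [[j0 qj0] hq wq]] := @weighted_cramer _ _ phi _ (poly_weight0 _)
  (poly_weight1 _) (@poly_weightN _) (@poly_weightD _) (@poly_weightM _) _ _ _ s0 hB.
  by move=> i; rewrite mxE.
(* As [e] is injective, [Q] is [q] carried to the columns in [S] and extended by zero. *)
pose Q y := \sum_(j | e j == y) q j.
(* Block [y] of the codeword is column 0 of [phi (Q y)], so each block of its syndrome is column 0
   of a matrix that [hq] makes zero. *)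
pose C : 'M['F_2]_(n, L.+1) := \matrix_(y, k) phi (Q y) k 0.
exists (mxvec C); split.
- rewrite mxvec_eq0; apply: contraNneq qj0 => C0.
  have Qj0 : Q (e j0) = q j0.
    by rewrite /Q (big_pred1 j0) // => j; rewrite /= (inj_eq eI).
  rewrite -Qj0; apply/eqP/horner_shift_col0 => i.
  by move/matrixP/(_ (e j0) i): C0; rewrite !mxE.
- apply/colP => r; rewrite [RHS]mxE; case/mxvec_indexP: r => x i.
  rewrite mxE reindex_mxvec /=.
  have /matrixP/(_ i 0) := hq x; rewrite [RHS]mxE; apply: etrans.
  have -> : \sum_j (\matrix_(i, j) hp i (e j)) x j * q j = \sum_y hp x y * Q y.
    rewrite (partition_big e predT) //=; apply: eq_bigr => y _.
    rewrite /Q mulr_sumr; by apply: eq_bigr => j /eqP <-; rewrite mxE.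
  rewrite rmorph_sum summxE; apply: eq_bigr => y _.
  rewrite rmorphM phi_hp mxE; apply: eq_bigr => k _.
  by rewrite [in LHS]mxE mxvecE !mxE.
- apply: leq_trans (leq_trans wq _); last first.
    apply: leq_trans (leq_sum_psi A eI eS); apply/eq_leq/eq_bigr => s _.
    by apply: eq_bigr => i _; rewrite mxE.
  rewrite /wt -sum1_card big_mkcond /= reindex_mxvec /=.
  rewrite (partition_big e predT) //=; apply: leq_sum => y _.
  apply: leq_trans (weight_sum (poly_weight0 _) (@poly_weightD _) _ _).
  apply: leq_trans (horner_shift_weight L (Q y)); rewrite -sum1_card [leqRHS]big_mkcond.
  by apply: leq_sum => k _; rewrite !inE mxvecE !mxE.
Qed.

(** The row permutation is invertible and cancels; the column permutation moves onto the
    codeword. *)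
Lemma codeword_row_col_perm r N (H : 'M['F_2]_(r, N)) (pr : 'S_r) (pc : 'S_N)
    (c : 'rV['F_2]_N) :
  is_codeword (row_perm pr (col_perm pc H)) c -> is_codeword H (col_perm pc^-1 c).
Proof.
rewrite /is_codeword row_permE col_permE => Hc.
rewrite tr_col_perm row_permE mulmxA.
apply: (can_inj (mulKmx (unitmx_perm _ pr))).
by rewrite mulmx0 -Hc !mulmxA.
Qed.

Lemma wt_col_perm N (s : 'S_N) (c : 'rV['F_2]_N) : wt (col_perm s c) = wt c.
Proof.
rewrite /wt -[RHS](card_preimset _ (@perm_inj _ s)); apply: eq_card => j.
by rewrite !inE mxE.
Qed.

Theorem theorem3 (s lam rho L : nat)
  (Hs : (0 < s)%N) (Hlam : (0 < lam)%N) (Hrho : (0 < rho)%N) (HL : (0 < L)%N)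
  (H : 'M['F_2]_(s * lam * L, s * rho * L))
  (pr : 'S_(s * lam * L)) (pc : 'S_(s * rho * L))
  (A : 'M[nat]_(s * lam, s * rho)) :
  (forall x y, circulant (block (row_perm pr (col_perm pc H)) x y)) ->
  (forall x y (i : 'I_L),
      #|[set j : 'I_L | block (row_perm pr (col_perm pc H)) x y i j != 0]| = A x y) ->
  forall S : {set 'I_(s * rho)},
    #|S| = (s * lam).+1 -> psi A S <> 0%N ->
    exists c : 'rV['F_2]_(s * rho * L),
      c != 0 /\ is_codeword H c /\ (wt c <= psi A S)%N.
Proof.
(* Writing the block size as a successor gives its indices the additive group used by the shift. *)
case: L HL H pr pc => // L _ H pr pc circH wtH S cS psi0.
have [c [c0 Hc wc]] := block_circulant_codeword circH wtH cS psi0.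
exists (col_perm pc^-1 c); split; last first.
  by split; [apply: codeword_row_col_perm Hc | rewrite wt_col_perm].
apply: contraNneq c0 => /(congr1 (col_perm pc)).
by rewrite -col_permM mulgV col_perm1 => ->; apply/eqP/rowP=> j; rewrite !mxE.
Qed.
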